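(* Let $\mathbb{M}$ be one of the modal systems $\mathsf{K},\mathsf{D},\mathsf{T},\mathsf{K4},\mathsf{S4}$. If $\vdash_{\mathbb{M}}A$, then the 2-sequent $\vdash A^{\langle\,\rangle}$ is provable in $2_{\mathbb{M}}$.
   Context: Hilbert systems: for a set $Z$ of modal formulas (over $\neg,\wedge,\vee,\to,\Box,\Diamond$), $\mathrm{K}Z$ is the smallest set of formulas containing $Z$, all instances of $A\to(B\to A)$, $(A\to(B\to C))\to((A\to B)\to(A\to C))$, $(\neg B\to\neg A)\to((\neg B\to A)\to B)$, $\Box(A\to B)\to(\Box A\to\Box B)$, and closed under modus ponens and necessitation (from $A$ infer $\Box A$). With $\mathbf D=\{\Box A\to\Diamond A\}$, $\mathbf T=\{\Box A\to A\}$, $\mathbf 4=\{\Box A\to\Box\Box A\}$ (all instances): $\mathsf K=\mathrm K\varnothing$, $\mathsf D=\mathrm K\mathbf D$, $\mathsf T=\mathrm K\mathbf T$, $\mathsf{K4}=\mathrm K\mathbf 4$, $\mathsf{S4}=\mathrm K\mathbf T\mathbf 4$; $\vdash_{\mathbb M}A$ means $A\in\mathbb M$. Fix a countably infinite set of tokens; a position is a finite (possibly empty) sequence of tokens, $\langle\,\rangle$ the empty one, $\circ$ concatenation, $\alpha\circ x=\alpha\circ\langle x\rangle$, $\beta\preceq\alpha$ means $\beta$ is a prefix of $\alpha$. A p-formula is $A^\alpha$ ($A$ modal formula, $\alpha$ position); a 2-sequent is $\Gamma\vdash\Delta$ with $\Gamma,\Delta$ finite (possibly empty) sequences of p-formulas;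 $I(\Gamma)=\{\beta:\exists A^\alpha\in\Gamma,\ \beta\preceq\alpha\}$. The calculus $2_{\mathsf{S4}}$: Axiom $A^\alpha\vdash A^\alpha$; Cut: from $\Gamma_1\vdash A^\alpha,\Delta_1$ and $\Gamma_2,A^\alpha\vdash\Delta_2$ infer $\Gamma_1,\Gamma_2\vdash\Delta_1,\Delta_2$; weakening, contraction, exchange on both sides; the classical propositional sequent rules for $\neg,\wedge,\vee,\to$ (two-premise rules with contexts joined) with all active p-formulas at the same position; modal rules: ($\Box\vdash$) from $\Gamma,A^{\alpha\circ\beta}\vdash\Delta$ infer $\Gamma,(\Box A)^\alpha\vdash\Delta$; ($\vdash\Box$) from $\Gamma\vdash A^{\alpha\circ x},\Delta$ infer $\Gamma\vdash(\Box A)^\alpha,\Delta$; ($\Diamond\vdash$) from $\Gamma,A^{\alpha\circ x}\vdash\Delta$ infer $\Gamma,(\Diamond A)^\alpha\vdash\Delta$; ($\vdash\Diamond$) from $\Gamma\vdash A^{\alpha\circ\beta},\Delta$ infer $\Gamma\vdash(\Diamond A)^\alpha,\Delta$; $\beta$ a position, $x$ a token, and in $\vdash\Box,\Diamond\vdash$ one requires $\alpha\circ x\notin I(\Gamma,\Delta)$. The calculi $2_{\mathsf T},2_{\mathsf D},2_{\mathsf{K4}},2_{\mathsf K}$ add constraints on $\Box\vdash,\vdash\Diamond$: $2_{\mathsf T}$: $\beta$ empty or a single token; $2_{\mathsf D}$: $\beta$ a single token; $2_{\mathsf{K4}}$: $\beta$ nonempty and $\Gamma$ or $\Delta$ contains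 some $B^{\alpha\circ\beta\circ\eta}$; $2_{\mathsf K}$: $\beta$ a single token and $\Gamma$ or $\Delta$ contains some $B^{\alpha\circ\beta\circ\eta}$. In $2_{\mathsf K},2_{\mathsf{K4}}$ Cut requires $\alpha\in I(\Gamma_1,\Delta_1)$ or $\alpha\in I(\Gamma_2,\Delta_2)$. *)

(* Defs.v *)
From Stdlib Require Import List FinFun.
Import ListNotations.

Set Implicit Arguments.
Unset Strict Implicit.
Unset Printing Implicit Defensive.

(* All six connectives are primitive; in particular [Dia A] is not an
   abbreviation of [Neg (Box (Neg A))]. *)
Inductive form (Atom : Type) : Type :=
| Var : Atom -> form Atom
| Neg : form Atom -> form Atom
| And : form Atom -> form Atom -> form Atom
| Or  : form Atom -> form Atom -> form Atom
| Imp : form Atom -> form Atom -> form Atom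
| Box : form Atom -> form Atom
| Dia : form Atom -> form Atom.

Inductive system : Set := SysK | SysD | SysT | SysK4 | SysS4.

Inductive hilbert (Atom : Type) (Z : form Atom -> Prop) : form Atom -> Prop :=
| H_Z A : Z A -> hilbert Z A
| H_1 A B : hilbert Z (Imp A (Imp B A))
| H_2 A B C :
    hilbert Z (Imp (Imp A (Imp B C)) (Imp (Imp A B) (Imp A C)))
| H_3 A B :
    hilbert Z (Imp (Imp (Neg B) (Neg A)) (Imp (Imp (Neg B) A) B))
| H_K A B : hilbert Z (Imp (Box (Imp A B)) (Imp (Box A) (Box B)))
| H_MP A B : hilbert Z A -> hilbert Z (Imp A B) -> hilbert Z B
| H_Nec A : hilbert Z A -> hilbert Z (Box A).

Definition schemaD (Atom : Type) (F : form Atom) : Prop :=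
  exists A, F = Imp (Box A) (Dia A).
Definition schemaT (Atom : Type) (F : form Atom) : Prop :=
  exists A, F = Imp (Box A) A.
Definition schema4 (Atom : Type) (F : form Atom) : Prop :=
  exists A, F = Imp (Box A) (Box (Box A)).

Definition axioms (Atom : Type) (M : system) (F : form Atom) : Prop :=
  match M with
  | SysK  => False
  | SysD  => schemaD F
  | SysT  => schemaT F
  | SysK4 => schema4 F
  | SysS4 => schemaT F \/ schema4 F
  end.

Definition hilbert_theorem (Atom : Type) (M : system) (A : form Atom) : Prop :=
  hilbert (axioms M) A.

Definition countably_infinite (T : Type) : Prop :=
  exists f : nat -> T, Bijective f.

Definition position (Token : Type) : Type := list Token.

Definition pform (Atom Token : Type) : Type :=
  (form Atom * position Token)%type.

Notation "A ^@ p" := (@pair (form _) (position _) A p)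
  (at level 30, no associativity).

Definition is_prefix (Token : Type) (b a : position Token) : Prop :=
  exists c, a = b ++ c.

(* [I_of G b] is b ∈ I(Γ); the set I(Γ,Δ) is [I_of (G ++ D)]. *)
Definition I_of (Atom Token : Type) (G : list (pform Atom Token))
    (b : position Token) : Prop :=
  exists A a, In (A ^@ a) G /\ is_prefix b a.

Definition is_token (Token : Type) (b : position Token) : Prop :=
  exists x, b = [x].

(* G and D are the side formulas of the rule; the active formula is excluded. *)
Definition occurs_above (Atom Token : Type) (a b : position Token)
    (G D : list (pform Atom Token)) : Prop :=
  exists B e, In (B ^@ (a ++ b ++ e)) G \/ In (B ^@ (a ++ b ++ e)) D.

(* Constraint on (Box ⊢) and (⊢ Dia), which pass from position a ++ b to a. *)
Definition modal_side (Atom Token : Type) (M : system) (a b : position Token)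
    (G D : list (pform Atom Token)) : Prop :=
  match M with
  | SysK  => is_token b /\ occurs_above a b G D
  | SysD  => is_token b
  | SysT  => b = [] \/ is_token b
  | SysK4 => b <> [] /\ occurs_above a b G D
  | SysS4 => True
  end.

Definition cut_side (Atom Token : Type) (M : system) (a : position Token)
    (G1 D1 G2 D2 : list (pform Atom Token)) : Prop :=
  match M with
  | SysK | SysK4 => I_of (G1 ++ D1) a \/ I_of (G2 ++ D2) a
  | SysD | SysT | SysS4 => True
  end.

Inductive provable2 (Atom Token : Type) (M : system) :
    list (pform Atom Token) -> list (pform Atom Token) -> Prop :=
| P_ax A a : provable2 M [A ^@ a] [A ^@ a]
| P_cut A a G1 D1 G2 D2 :
    cut_side M a G1 D1 G2 D2 ->
    provable2 M G1 ([A ^@ a] ++ D1) ->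
    provable2 M (G2 ++ [A ^@ a]) D2 ->
    provable2 M (G1 ++ G2) (D1 ++ D2)
| P_wkL A a G D :
    provable2 M G D -> provable2 M (G ++ [A ^@ a]) D
| P_wkR A a G D :
    provable2 M G D -> provable2 M G ([A ^@ a] ++ D)
| P_ctrL A a G D :
    provable2 M (G ++ [A ^@ a; A ^@ a]) D -> provable2 M (G ++ [A ^@ a]) D
| P_ctrR A a G D :
    provable2 M G ([A ^@ a; A ^@ a] ++ D) -> provable2 M G ([A ^@ a] ++ D)
| P_exL A a B b G1 G2 D :
    provable2 M (G1 ++ [A ^@ a; B ^@ b] ++ G2) D ->
    provable2 M (G1 ++ [B ^@ b; A ^@ a] ++ G2) D
| P_exR A a B b G D1 D2 :
    provable2 M G (D1 ++ [A ^@ a; B ^@ b] ++ D2) ->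
    provable2 M G (D1 ++ [B ^@ b; A ^@ a] ++ D2)
| P_negL A a G D :
    provable2 M G ([A ^@ a] ++ D) ->
    provable2 M (G ++ [Neg A ^@ a]) D
| P_negR A a G D :
    provable2 M (G ++ [A ^@ a]) D ->
    provable2 M G ([Neg A ^@ a] ++ D)
| P_andL1 A B a G D :
    provable2 M (G ++ [A ^@ a]) D ->
    provable2 M (G ++ [And A B ^@ a]) D
| P_andL2 A B a G D :
    provable2 M (G ++ [B ^@ a]) D ->
    provable2 M (G ++ [And A B ^@ a]) D
| P_andR A B a G1 D1 G2 D2 :
    provable2 M G1 ([A ^@ a] ++ D1) ->
    provable2 M G2 ([B ^@ a] ++ D2) ->
    provable2 M (G1 ++ G2) ([And A B ^@ a] ++ D1 ++ D2)
| P_orL A B a G1 D1 G2 D2 :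
    provable2 M (G1 ++ [A ^@ a]) D1 ->
    provable2 M (G2 ++ [B ^@ a]) D2 ->
    provable2 M (G1 ++ G2 ++ [Or A B ^@ a]) (D1 ++ D2)
| P_orR1 A B a G D :
    provable2 M G ([A ^@ a] ++ D) ->
    provable2 M G ([Or A B ^@ a] ++ D)
| P_orR2 A B a G D :
    provable2 M G ([B ^@ a] ++ D) ->
    provable2 M G ([Or A B ^@ a] ++ D)
| P_impL A B a G1 D1 G2 D2 :
    provable2 M G1 ([A ^@ a] ++ D1) ->
    provable2 M (G2 ++ [B ^@ a]) D2 ->
    provable2 M (G1 ++ G2 ++ [Imp A B ^@ a]) (D1 ++ D2)
| P_impR A B a G D :
    provable2 M (G ++ [A ^@ a]) ([B ^@ a] ++ D) ->
    provable2 M G ([Imp A B ^@ a] ++ D)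
| P_boxL A a b G D :
    modal_side M a b G D ->
    provable2 M (G ++ [A ^@ (a ++ b)]) D ->
    provable2 M (G ++ [Box A ^@ a]) D
| P_boxR A a x G D :
    ~ I_of (G ++ D) (a ++ [x]) ->
    provable2 M G ([A ^@ (a ++ [x])] ++ D) ->
    provable2 M G ([Box A ^@ a] ++ D)
| P_diaL A a x G D :
    ~ I_of (G ++ D) (a ++ [x]) ->
    provable2 M (G ++ [A ^@ (a ++ [x])]) D ->
    provable2 M (G ++ [Dia A ^@ a]) D
| P_diaR A a b G D :
    modal_side M a b G D ->
    provable2 M G ([A ^@ (a ++ b)] ++ D) ->
    provable2 M G ([Dia A ^@ a] ++ D).

(* Main.v *)
Require Import Defs.
From Stdlib Require Import List Permutation.
Import ListNotations.

(** Induction on the Hilbert derivation. Necessitation is the only step that is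
    not a local derivation: prefixing every position of a 2-derivation by a fixed
    position [p] preserves all rules and their side conditions, because
    [q |-> p ++ q] preserves and reflects the prefix order. So [|- A^<>] gives
    [|- A^<x>], and [x] is trivially fresh there. In K and K4, modus ponens is
    simulated by cuts in which the conclusion [B^<>] witnesses the side condition. *)

Section Calculus.

Set Implicit Arguments.

Variables (Atom Token : Type) (M : system).
Implicit Types (A B C : form Atom) (p q : position Token)
  (G D : list (pform Atom Token)).

(** * Prefixing all positions *)

Definition shift p (F : pform Atom Token) : pform Atom Token :=
  (fst F, p ++ snd F).

Lemma in_shift p G A q :
  In (A ^@ q) G -> In (A ^@ (p ++ q)) (map (shift p) G).
Proof. exact (in_map (shift p) G (A ^@ q)). Qed.

(** Left to right transfers freshness; right to left transfers the cut condition. *)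
Lemma I_of_shift p G q : I_of (map (shift p) G) (p ++ q) <-> I_of G q.
Proof.
split.
- intros (A & a & Hin & c & ->).
  apply in_map_iff in Hin as ([A' a'] & E & Hin).
  injection E as -> E; cbn in E.
  rewrite <- app_assoc in E; apply app_inv_head in E as ->.
  exists A, (q ++ c); split; [exact Hin | now exists c].
- intros (A & a & Hin & c & ->).
  exists A, (p ++ q ++ c); split; [now apply in_shift |].
  exists c; apply app_assoc.
Qed.

Lemma occurs_above_shift p q b G D :
  occurs_above q b G D ->
  occurs_above (p ++ q) b (map (shift p) G) (map (shift p) D).
Proof.
intros (B & e & H); exists B, e; rewrite <- app_assoc.
destruct H as [H | H]; [left | right]; now apply in_shift.
Qed.

Lemma modal_side_shift p q b G D :
  modal_side M q b G D ->
  modal_side M (p ++ q) b (map (shift p) G) (map (shift p) D).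
Proof.
destruct M; cbn; intuition auto using occurs_above_shift.
Qed.

Lemma cut_side_shift p q G1 D1 G2 D2 :
  cut_side M q G1 D1 G2 D2 ->
  cut_side M (p ++ q) (map (shift p) G1) (map (shift p) D1)
    (map (shift p) G2) (map (shift p) D2).
Proof.
destruct M; cbn; rewrite <- ?map_app, ?I_of_shift; exact (fun H => H).
Qed.

Lemma fresh_shift p q x G D :
  ~ I_of (G ++ D) (q ++ [x]) ->
  ~ I_of (map (shift p) G ++ map (shift p) D) ((p ++ q) ++ [x]).
Proof. now rewrite <- map_app, <- app_assoc, I_of_shift. Qed.

Lemma provable2_shift p G D :
  provable2 M G D -> provable2 M (map (shift p) G) (map (shift p) D).
Proof.
induction 1; rewrite ?map_app in *; cbn in *.
- apply P_ax.
- eapply P_cut; eauto using cut_side_shift.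
- now apply P_wkL.
- now apply P_wkR.
- now apply P_ctrL.
- now apply P_ctrR.
- now apply P_exL.
- now apply P_exR.
- now apply P_negL.
- now apply P_negR.
- now apply P_andL1.
- now apply P_andL2.
- now apply P_andR.
- now apply P_orL.
- now apply P_orR1.
- now apply P_orR2.
- now apply P_impL.
- now apply P_impR.
- eapply P_boxL; [apply modal_side_shift; eassumption |].
  now rewrite <- app_assoc.
- eapply P_boxR; [apply fresh_shift; eassumption |].
  now rewrite <- app_assoc.
- eapply P_diaL; [apply fresh_shift; eassumption |].
  now rewrite <- app_assoc.
- eapply P_diaR; [apply modal_side_shift; eassumption |].
  now rewrite <- app_assoc.
Qed.

(** * Structural tools and propositional axioms *)

Lemma provable2_permL G G' D :
  Permutation G G' -> provable2 M G D -> provable2 M G' D.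
Proof.
intros HP.
(* The skip case of the induction moves the common head formula into the left context, hence the
   generalization over [G0]. *)
enough (H : forall G0, provable2 M (G0 ++ G) D -> provable2 M (G0 ++ G') D)
  by exact (H []).
induction HP as [| F G G' _ IH | [A a] [B b] G | G G' G'' _ IH1 _ IH2];
  intros G0 H; auto.
- specialize (IH (G0 ++ [F])); rewrite <- !app_assoc in IH; auto.
- now apply (P_exL (G2 := G)).
Qed.

Lemma provable2_imp A B q :
  provable2 M [A ^@ q] [B ^@ q] -> provable2 M [] [Imp A B ^@ q].
Proof. exact (P_impR (G := []) (D := [])). Qed.

(** Keeping the principal formula at the head, not at the end, lets concrete sequents match by
    computation. *)
Lemma provable2_impL A B q G1 G2 D1 D2 :
  provable2 M G1 (A ^@ q :: D1) -> provable2 M (B ^@ q :: G2) D2 ->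
  provable2 M (Imp A B ^@ q :: G1 ++ G2) (D1 ++ D2).
Proof.
intros H1 H2.
apply (@provable2_permL (G1 ++ G2 ++ [Imp A B ^@ q])).
{ rewrite app_assoc; symmetry; apply Permutation_cons_append. }
apply P_impL; [exact H1 |].
exact (provable2_permL (Permutation_cons_append _ _) H2).
Qed.

Lemma provable2_H1 A B q : provable2 M [] [Imp A (Imp B A) ^@ q].
Proof.
apply provable2_imp, (P_impR (G := [A ^@ q]) (D := [])).
apply (P_wkL B q (G := [A ^@ q])), P_ax.
Qed.

Lemma provable2_H2 A B C q :
  provable2 M [] [Imp (Imp A (Imp B C)) (Imp (Imp A B) (Imp A C)) ^@ q].
Proof.
set (F := Imp A (Imp B C)).
apply provable2_imp, (P_impR (G := [F ^@ q]) (D := [])).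
apply (P_impR (G := [F ^@ q; Imp A B ^@ q]) (D := [])).
(* [A] is used twice: to detach [Imp B C] from [F], and to obtain [B]. *)
apply (P_ctrL (G := [F ^@ q; Imp A B ^@ q])); cbn.
apply (@provable2_permL [F ^@ q; A ^@ q; Imp A B ^@ q; A ^@ q]).
{ apply perm_skip, perm_swap. }
apply (@provable2_impL A (Imp B C) q [A ^@ q] [Imp A B ^@ q; A ^@ q] [] [C ^@ q]);
  [apply P_ax |].
apply (@provable2_permL [Imp A B ^@ q; A ^@ q; Imp B C ^@ q]).
{ exact (Permutation_app_comm [_; _] [_]). }
apply (@provable2_impL A B q [A ^@ q] [Imp B C ^@ q] [] [C ^@ q]);
  [apply P_ax |].
eapply provable2_permL; [apply perm_swap |].
apply (@provable2_impL B C q [B ^@ q] [] [] [C ^@ q]); apply P_ax.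
Qed.

Lemma provable2_H3 A B q :
  provable2 M []
    [Imp (Imp (Neg B) (Neg A)) (Imp (Imp (Neg B) A) B) ^@ q].
Proof.
assert (HB : provable2 M [] [Neg B ^@ q; B ^@ q]).
{ apply (P_negR (G := []) (D := [B ^@ q])), P_ax. }
apply provable2_imp,
  (P_impR (G := [Imp (Neg B) (Neg A) ^@ q]) (D := [])).
(* Both implications have premise [Neg B]. Each is discharged by excluded middle [HB], which leaves
   a [B] on the right, so two copies are required. *)
apply (P_ctrR (D := [])).
apply (@provable2_impL (Neg B) (Neg A) q [] [Imp (Neg B) A ^@ q] [B ^@ q] [B ^@ q]);
  [exact HB |].
eapply provable2_permL; [apply perm_swap |].
apply (@provable2_impL (Neg B) A q [] [Neg A ^@ q] [B ^@ q] []); [exact HB |].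
apply (P_negL (G := [A ^@ q]) (D := [])), P_ax.
Qed.

(** * Modal axioms *)

(** A prefix is never longer than the position it begins. Freshness thus follows from length alone,
    and one token can be reused at every depth. *)
Lemma not_I_of_longer G (a : Token) q :
  (forall F, In F G -> length (snd F) <= length q) -> ~ I_of G (q ++ [a]).
Proof.
intros HG (A & r & Hin & c & ->).
apply HG in Hin; cbn in Hin.
rewrite !length_app, <- PeanoNat.Nat.add_assoc in Hin; cbn in Hin.
rewrite PeanoNat.Nat.add_succ_r in Hin.
apply (PeanoNat.Nat.nle_succ_diag_l (length q)).
etransitivity; [| exact Hin].
apply le_n_S, PeanoNat.Nat.le_add_r.
Qed.

Lemma provable2_HK (x : Token) A B q :
  provable2 M [] [Imp (Box (Imp A B)) (Imp (Box A) (Box B)) ^@ q].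
Proof.
(* Read upwards, the right box rule comes first: it puts [B] at [q ++ [x]], and this side formula
   licenses both left box rules in K and K4. *)
assert (Hside : forall G, modal_side M q [x] G [B ^@ (q ++ [x])]).
{ intros G.
  assert (Hab : occurs_above q [x] G [B ^@ (q ++ [x])])
    by (exists B, []; right; left; reflexivity).
  assert (Hx : is_token [x]) by now exists x.
  assert (Hne : [x] <> []) by discriminate.
  destruct M; cbn; auto. }
apply provable2_imp,
  (P_impR (G := [Box (Imp A B) ^@ q]) (D := [])).
apply (P_boxR (x := x) (D := [])).
{ apply not_I_of_longer; intros F [<- | [<- | []]]; apply le_n. }
apply (P_boxL (b := [x]) (G := [Box (Imp A B) ^@ q])); [apply Hside |].
eapply provable2_permL; [apply perm_swap |].
apply (P_boxL (b := [x]) (G := [A ^@ (q ++ [x])])); [apply Hside |].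
eapply provable2_permL; [apply perm_swap |].
apply (@provable2_impL A B (q ++ [x]) [A ^@ (q ++ [x])] [] [] [B ^@ (q ++ [x])]);
  apply P_ax.
Qed.

(** [M] is arbitrary here, so the side conditions stay hypotheses, discharged later for the systems
    that have the axiom; likewise for T and 4. *)
Lemma provable2_axD (x : Token) A q :
  modal_side M q [x] [] [Dia A ^@ q] ->
  modal_side M q [x] [A ^@ (q ++ [x])] [] ->
  provable2 M [] [Imp (Box A) (Dia A) ^@ q].
Proof.
intros HL HR; apply provable2_imp.
apply (P_boxL (b := [x]) (G := [])); [exact HL |].
apply (P_diaR (b := [x]) (D := [])); [exact HR | apply P_ax].
Qed.

Lemma provable2_axT A q :
  modal_side M q [] [] [A ^@ q] -> provable2 M [] [Imp (Box A) A ^@ q].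
Proof.
intros HL; apply provable2_imp.
apply (P_boxL (b := []) (G := [])); [exact HL |].
rewrite app_nil_r; apply P_ax.
Qed.

Lemma provable2_ax4 (x : Token) A q :
  modal_side M q [x; x] [] [A ^@ (q ++ [x; x])] ->
  provable2 M [] [Imp (Box A) (Box (Box A)) ^@ q].
Proof.
intros HL; apply provable2_imp.
apply (P_boxR (x := x) (D := [])).
{ apply not_I_of_longer; intros F [<- | []]; apply le_n. }
apply (P_boxR (x := x) (D := [])).
{ apply not_I_of_longer; intros F [<- | []]; cbn.
  rewrite length_app; apply PeanoNat.Nat.le_add_r. }
rewrite <- app_assoc.
(* A single left rule jumps two levels; the succedent [A], already at [q ++ [x; x]], is the witness
   required in K4. *)
apply (P_boxL (b := [x; x]) (G := [])); [exact HL | apply P_ax].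
Qed.

Lemma provable2_axioms (x : Token) A q :
  axioms M A -> provable2 M [] [A ^@ q].
Proof.
intros HA.
(* Regrouping by schema treats T and 4 once each, although S4 shares both. *)
assert (HM : (M = SysD /\ schemaD A) \/ ((M = SysT \/ M = SysS4) /\ schemaT A)
             \/ ((M = SysK4 \/ M = SysS4) /\ schema4 A)).
{ destruct M; cbn in HA; tauto. }
destruct HM as [[E [B ->]] | [[E [B ->]] | [E [B ->]]]].
- apply (@provable2_axD x); rewrite E; now exists x.
- apply provable2_axT; destruct E as [-> | ->]; [now left | exact I].
- apply (@provable2_ax4 x); destruct E as [-> | ->]; [| exact I].
  split; [discriminate |].
  exists B, []; right; left; reflexivity.
Qed.

(** * Modus ponens, necessitation and the main induction *)

Lemma provable2_cut_theorem A B G q :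
  provable2 M [] [A ^@ q] -> provable2 M (G ++ [A ^@ q]) [B ^@ q] ->
  provable2 M G [B ^@ q].
Proof.
intros HA HB.
refine (P_cut (G1 := []) (D1 := []) _ HA HB).
assert (HI : I_of (G ++ [B ^@ q]) q).
{ exists B, q; split; [apply in_or_app; right; now left |].
  exists []; symmetry; apply app_nil_r. }
destruct M; cbn; auto.
Qed.

Lemma provable2_MP A B q :
  provable2 M [] [A ^@ q] -> provable2 M [] [Imp A B ^@ q] ->
  provable2 M [] [B ^@ q].
Proof.
intros HA HAB.
(* The lower cut removes [A], the upper one [Imp A B] in the context [A]; what remains is
   [A, Imp A B] entailing [B]. *)
apply (provable2_cut_theorem [] HA), (provable2_cut_theorem _ HAB).
apply (P_impL (G1 := [A ^@ q]) (D1 := []) (G2 := [])); apply P_ax.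
Qed.

Lemma provable2_nec (x : Token) A :
  provable2 M [] [A ^@ ([] : position Token)] ->
  provable2 M [] [Box A ^@ ([] : position Token)].
Proof.
intros HA; apply (P_boxR (x := x) (G := []) (D := [])).
- apply not_I_of_longer; intros F [].
- exact (provable2_shift [x] HA).
Qed.

Lemma hilbert_provable2 (x : Token) A :
  hilbert_theorem M A -> provable2 M [] [A ^@ ([] : position Token)].
Proof.
induction 1.
- now apply (provable2_axioms x).
- apply provable2_H1.
- apply provable2_H2.
- apply provable2_H3.
- now apply provable2_HK.
- exact (provable2_MP IHhilbert1 IHhilbert2).
- now apply (provable2_nec x).
Qed.

End Calculus.

Theorem mainTheorem4 (Atom Token : Type) (HToken : countably_infinite Token)
    (M : system) (A : form Atom) :
  hilbert_theorem M A ->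
  provable2 (Token := Token) M [] [A ^@ []].
Proof.
(* The enumeration supplies [f 0] as the token [x] of the derivations above. *)
destruct HToken as [f _]; exact (hilbert_provable2 (M := M) (f 0) (A := A)).
Qed.
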